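(* Let $(v_0,v)\in\mathbb{R}\times\mathbb{R}^n$ with $\|v\|_0\ge 3$, where $\|v\|_0$ is the number of nonzero entries of $v$. Let $\hat x\in\mathbb{R}^n$ and let $\hat X$ be a real symmetric $n\times n$ matrix such that $(\hat x,\hat X)\notin\mathrm{QPB}_n$, and suppose that $(\hat x,\hat X)$ satisfies the SDP constraint $$\begin{bmatrix}1&\hat x^{\top}\\ \hat x&\hat X\end{bmatrix}\succeq 0$$ and the McCormick inequalities $\hat X_{i,j}\le \hat x_i$, $\hat X_{i,j}\le\hat x_j$, $\hat X_{i,j}\ge 0$, $\hat X_{i,j}\ge\hat x_i+\hat x_j-1$ for all $i\neq j$ in $\{1,\dots,n\}$. Then the maximum violation (depth of cut) of $(\hat x,\hat X)$ for the inequality $\mathrm{E\text{-}CG}(v_0,v)$ is at most $$\frac{2}{\sqrt{\|v\|_0\,(\|v\|_0-2)}}.$$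
   Context: $\mathrm{QPB}_n=\operatorname{conv}\{(x,X)\in[0,1]^{n+\binom{n+1}{2}} : X_{i,j}=x_ix_j,\ 1\le i\le j\le n\}$; a symmetric matrix $X$ is identified with its entries $(X_{i,j})_{1\le i\le j\le n}$. For $v_0\in\mathbb{R}$, $v\in\mathbb{R}^n$, $\mathrm{E\text{-}CG}(v_0,v)=(\alpha,\beta,\gamma)$ with $\alpha_i=\lceil v_i^2+2v_iv_0\rceil$ for $i\in\{1,\dots,n\}$, $\beta_{ij}=\lceil 2v_iv_j\rceil$ for $1\le i<j\le n$, $\gamma=\lfloor v_0^2\rfloor$, representing the inequality $\sum_{i<j}\beta_{ij}X_{i,j}+\sum_i\alpha_ix_i+\gamma\ge0$. The depth (violation) of a cut $a^{\top}z\le b$ at a point $z^*$ is $(a^{\top}z^*-b)/\|a\|_2$. For the inequality $\mathrm{E\text{-}CG}(v_0,v)$ at $(\hat x,\hat X)$ this is $$\frac{-\gamma-\sum_{i<j}\beta_{ij}\hat X_{i,j}-\sum_i\alpha_i\hat x_i}{\sqrt{\sum_{i<j}\beta_{ij}^2+\sum_i\alpha_i^2}}.$$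
   Formalization: The formal theorem also assumes the diagonal McCormick inequality X_ii ≤ x_i for all i; without it the claim fails, e.g. n = 10, v = (1,…,1), v0 = −5, x = (1/2,…,1/2), X = 10·I has depth about 0.636 against the bound 0.224. *)

(* Defs.v *)
From HB Require Import structures.
From mathcomp Require Import all_boot all_order all_algebra.
From mathcomp Require Import boolp classical_sets reals convex.

Set Implicit Arguments.
Unset Strict Implicit.
Unset Printing Implicit Defensive.

Import Order.TTheory GRing.Theory Num.Theory.

Local Open Scope classical_set_scope.
Local Open Scope ring_scope.

Definition conv_hull (R : realType) (M : lmodType R) (A : set M) : set M :=
  smallest (@convex_set R M) A.

(* A family (X_{i,j})_{i <= j} is encoded as the symmetric matrix it determines;
   this is a linear bijection, so convex hulls correspond. *)
Definition QPB (R : realType) (n : nat) : set ('cV[R]_n * 'M[R]_n)%type :=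
  @conv_hull R ('cV[R]_n * 'M[R]_n)%type
    [set z : 'cV[R]_n * 'M[R]_n |
      [/\ forall i : 'I_n, 0 <= z.1 i 0 <= 1,
          forall i j : 'I_n, 0 <= z.2 i j <= 1,
          z.2^T = z.2
        & forall i j : 'I_n, (i <= j)%N -> z.2 i j = z.1 i 0 * z.1 j 0]].

Definition psd (R : realType) (m : nat) (M : 'M[R]_m) : Prop :=
  M^T = M /\ forall u : 'cV[R]_m, 0 <= (u^T *m M *m u) 0 0.

Definition sdp_constraint (R : realType) (n : nat)
    (x : 'cV[R]_n) (X : 'M[R]_n) : Prop :=
  psd (block_mx (1%:M : 'M[R]_1) x^T x X).

(* Off-diagonal only. The i = j instance X_ii <= x_i is not included here and not
   implied by [sdp_constraint]; it is what compares the quadratic form of the SDP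
   with E-CG, where x_i stands in place of X_ii. *)
Definition mccormick (R : realType) (n : nat)
    (x : 'cV[R]_n) (X : 'M[R]_n) : Prop :=
  forall i j : 'I_n, i != j ->
    [/\ X i j <= x i 0, X i j <= x j 0, 0 <= X i j
      & x i 0 + x j 0 - 1 <= X i j].

Definition norm0 (R : realType) (n : nat) (v : 'cV[R]_n) : nat :=
  #|[set i : 'I_n | v i 0 != 0]%SET|.

Definition ecg_alpha (R : realType) (n : nat) (v0 : R) (v : 'cV[R]_n)
    (i : 'I_n) : int :=
  Num.ceil (v i 0 ^+ 2 + 2 * v i 0 * v0).

Definition ecg_beta (R : realType) (n : nat) (v : 'cV[R]_n)
    (i j : 'I_n) : int :=
  Num.ceil (2 * v i 0 * v j 0).

Definition ecg_gamma (R : realType) (v0 : R) : int := Num.floor (v0 ^+ 2).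

(* Left-hand side of the inequality E-CG(v0, v), which reads 0 <= ecg_lhs. *)
Definition ecg_lhs (R : realType) (n : nat) (v0 : R) (v : 'cV[R]_n)
    (x : 'cV[R]_n) (X : 'M[R]_n) : R :=
  \sum_(i < n) \sum_(j < n | (i < j)%N) (ecg_beta v i j)%:~R * X i j
  + \sum_(i < n) (ecg_alpha v0 v i)%:~R * x i 0 + (ecg_gamma v0)%:~R.

(* Signed depth: it is negative at points satisfying the inequality strictly. *)
Definition ecg_depth (R : realType) (n : nat) (v0 : R) (v : 'cV[R]_n)
    (x : 'cV[R]_n) (X : 'M[R]_n) : R :=
  - ecg_lhs v0 v x X /
  Num.sqrt (\sum_(i < n) \sum_(j < n | (i < j)%N) (ecg_beta v i j)%:~R ^+ 2
            + \sum_(i < n) (ecg_alpha v0 v i)%:~R ^+ 2).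

(* Main.v *)
Require Import Defs.
From mathcomp Require Import all_boot all_order all_algebra.
From mathcomp Require Import boolp classical_sets reals convex.
From mathcomp Require Import ring lra.

Import Order.TTheory GRing.Theory Num.Theory.

Local Open Scope classical_set_scope.
Local Open Scope ring_scope.

(** The depth is a quotient, and its two parts are bounded separately.

    Numerator.  Evaluating the SDP form at [(v0, v)] gives
    [v0^2 + sum_i 2 v_i v0 x_i + sum_i v_i^2 X_ii + sum_(i<j) 2 v_i v_j X_ij >= 0].
    Since [X_ii <= x_i], replacing the diagonal entries [X_ii] by [x_i] keeps
    this true.  As [x_i] and [X_ij] are nonnegative, rounding their coefficients
    up only increases the left-hand side, and rounding [v0^2] down costs at most
    one, so the violation is at most 1 ([ecg_violation_le1]).

    Denominator.  If [v_i] and [v_j] have the same nonzero sign, then [beta_ij]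
    is the ceiling of a positive number, hence at least 1; if the signs are
    opposite it may vanish.  So the squared norm is at least the number of
    same-sign pairs among the [k] nonzero entries of [v], which is smallest when
    the two signs are balanced, and is always at least [k(k-2)/4]
    ([ecg_beta_norm_ge]).  Dividing, the depth is at most
    [1 / sqrt (k(k-2)/4) = 2 / sqrt (k(k-2))]. *)

Lemma sum_sym_offdiag (V : nmodType) (n : nat) (F : 'I_n -> 'I_n -> V) :
  (forall i j, F i j = F j i) ->
  \sum_i \sum_j F i j =
    \sum_i F i i + (\sum_(i < n) \sum_(j < n | (i < j)%N) F i j) *+ 2.
Proof.
move=> Fsym.
have split_row (i : 'I_n) : \sum_j F i j =
    F i i + (\sum_(j < n | (i < j)%N) F i j + \sum_(j < n | (j < i)%N) F i j).
  rewrite (bigD1 i) //=; congr (_ + _).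
  rewrite (bigID (fun j : 'I_n => (i < j)%N)) /=; congr (_ + _);
    apply: eq_bigl => j.
    by rewrite -val_eqE /=; case: ltngtP.
  by rewrite -val_eqE /=; case: ltngtP.
rewrite (eq_bigr _ (fun i _ => split_row i)) !big_split /= mulr2n.
congr (_ + (_ + _)).
rewrite (exchange_big_dep xpredT) //=.
by apply: eq_bigr => j _; apply: eq_bigr => i _.
Qed.

Lemma sqr_sum_offdiag (R : comPzRingType) (n : nat) (a : 'I_n -> R) :
  (\sum_i a i) ^+ 2 =
    \sum_i a i ^+ 2 + (\sum_(i < n) \sum_(j < n | (i < j)%N) a i * a j) *+ 2.
Proof.
rewrite expr2 big_distrlr /= sum_sym_offdiag; last by move=> i j; rewrite mulrC.
by [].
Qed.

Lemma sdp_form_ge0 (R : realType) (n : nat) (v0 : R) (v x : 'cV[R]_n)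
    (X : 'M[R]_n) :
  sdp_constraint x X ->
  0 <= v0 ^+ 2 + \sum_i 2 * v i 0 * v0 * x i 0
       + \sum_i \sum_j v i 0 * v j 0 * X i j.
Proof.
case=> _ /(_ (col_mx v0%:M v)).
rewrite tr_col_mx mul_row_block mul_row_col mulmxDl !mulmxDl.
rewrite tr_scalar_mx mulmx1 -scalar_mxM !mul_scalar_mx mul_mx_scalar.
rewrite -!scalemxAl !mxE eqxx mulr1n -expr2 => h.
apply: le_trans h _; rewrite le_eqVlt; apply/orP; left; apply/eqP.
have xv : \sum_j x^T 0 j * v j 0 = \sum_i v i 0 * x i 0.
  by apply: eq_bigr => i _; rewrite mxE mulrC.
have vx : \sum_j v^T 0 j * x j 0 = \sum_i v i 0 * x i 0.
  by apply: eq_bigr => i _; rewrite mxE.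
have quad : \sum_j (v^T *m X) 0 j * v j 0 =
    \sum_i \sum_j v i 0 * v j 0 * X i j.
  rewrite exchange_big /=; apply: eq_bigr => j _.
  rewrite mxE big_distrl /=; apply: eq_bigr => i _.
  by rewrite !mxE; ring.
have lin : \sum_i 2 * v i 0 * v0 * x i 0 =
    2 * v0 * \sum_i v i 0 * x i 0.
  by rewrite big_distrr /=; apply: eq_bigr => i _; ring.
by rewrite xv vx quad lin; ring.
Qed.

(** Rounding can lower the left-hand side of the inequality given by the SDP form
    only by less than one, because only the constant term is rounded down. *)
Lemma ecg_violation_le1 (R : realType) (n : nat) (v0 : R) (v x : 'cV[R]_n)
    (X : 'M[R]_n) :
  sdp_constraint x X ->
  (forall i, X i i <= x i 0) ->
  (forall i, 0 <= x i 0) ->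
  (forall i j, i != j -> 0 <= X i j) ->
  - ecg_lhs v0 v x X <= 1.
Proof.
move=> sdp Xx x0 X0; have Xsym i j : X i j = X j i.
  case: (sdp) => + _; rewrite tr_block_mx => /eq_block_mx[_ _ _ {1}<-].
  by rewrite mxE.
have := sdp_form_ge0 _ _ v0 v _ _ sdp.
rewrite sum_sym_offdiag; last by move=> i j; rewrite Xsym; ring.
have diag : \sum_i v i 0 * v i 0 * X i i <= \sum_i v i 0 ^+ 2 * x i 0.
  by apply: ler_sum => i _; rewrite -expr2 ler_wpM2l ?sqr_ge0.
have alpha : \sum_i v i 0 ^+ 2 * x i 0 + \sum_i 2 * v i 0 * v0 * x i 0
    <= \sum_i (ecg_alpha v0 v i)%:~R * x i 0.
  rewrite -big_split /=; apply: ler_sum => i _.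
  by rewrite -mulrDl ler_wpM2r // ceil_ge.
have beta : (\sum_(i < n) \sum_(j < n | (i < j)%N) v i 0 * v j 0 * X i j) *+ 2
    <= \sum_(i < n) \sum_(j < n | (i < j)%N) (ecg_beta v i j)%:~R * X i j.
  rewrite -sumrMnl; apply: ler_sum => i _.
  rewrite -sumrMnl; apply: ler_sum => j ij.
  rewrite -mulrnAl ler_wpM2r //.
    by rewrite X0 // -val_eqE /= neq_ltn ij.
  by rewrite -mulr_natl mulrA ceil_ge.
have gamma : v0 ^+ 2 < (ecg_gamma v0)%:~R + 1.
  by rewrite -[1]/(1%:~R) -intrD floorD1_gt.
rewrite /ecg_lhs; lra.
Qed.

(** The left-hand side is the indicator of [a] and [b] having the same nonzero
    sign, written as a polynomial in the signs and their absolute values so that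
    it can be summed over pairs in closed form. *)
Lemma sgr_pair_le_sqr_ceil (R : realType) (a b : R) :
  (Num.sg a * Num.sg b + `|Num.sg a| * `|Num.sg b|) / 2
    <= (Num.ceil (2 * a * b))%:~R ^+ 2.
Proof.
have [ab0|ab0] := ltP 0 (a * b).
  have c1 : (1 : R) <= (Num.ceil (2 * a * b))%:~R.
    by rewrite -[1]/(1%:~R) ler_int -gtz0_ge1 ceil_gt0 -mulrA mulr_gt0.
  rewrite -sgrM -normrM -sgrM gtr0_sg // normr1; nra.
apply: le_trans (sqr_ge0 _).
rewrite -sgrM -normrM -sgrM ler0_norm ?subrr ?mul0r //.
by rewrite sgr_le0.
Qed.

(** With [s_i] the sign of [v_i], the same-sign pairs are counted by
    [sum_(i<j) (s_i s_j + |s_i s_j|) / 2].  Twice the sum of the [s_i s_j] is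
    [(sum_i s_i)^2 - k >= - k], and twice the sum of the [|s_i s_j|] is
    [k^2 - k]. *)
Lemma ecg_beta_norm_ge (R : realType) (n : nat) (v : 'cV[R]_n) :
  (norm0 v)%:R * ((norm0 v)%:R - 2) / 4
    <= \sum_(i < n) \sum_(j < n | (i < j)%N) ((ecg_beta v i j)%:~R : R) ^+ 2.
Proof.
pose s i := Num.sg (v i 0).
have sum_abs : \sum_i `|s i| = (norm0 v)%:R.
  rewrite /norm0 -sum1_card natr_sum [RHS]big_mkcond /=.
  by apply: eq_bigr => i _; rewrite inE normr_sg; case: eqP.
have sum_sqr : \sum_i s i ^+ 2 = (norm0 v)%:R.
  rewrite -sum_abs; apply: eq_bigr => i _.
  by rewrite sqr_sg normr_sg.
have := sqr_sum_offdiag _ _ s; have := sqr_sum_offdiag _ _ (fun i => `|s i|).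
rewrite sum_abs.
under [X in _ = X + _ -> _]eq_bigr do rewrite real_normK ?num_real //.
rewrite sum_sqr => eq_abs eq_sg.
have := sqr_ge0 (\sum_i s i); rewrite eq_sg => ge_sg.
have pairs : (\sum_(i < n) \sum_(j < n | (i < j)%N) s i * s j
    + \sum_(i < n) \sum_(j < n | (i < j)%N) `|s i| * `|s j|) / 2
    <= \sum_(i < n) \sum_(j < n | (i < j)%N) ((ecg_beta v i j)%:~R : R) ^+ 2.
  rewrite -big_split /= big_distrl /=; apply: ler_sum => i _.
  rewrite -big_split /= big_distrl /=; apply: ler_sum => j _.
  exact: sgr_pair_le_sqr_ceil.
apply: le_trans pairs; nra.
Qed.

Theorem proposition6 (R : realType) (n : nat) (v0 : R) (v : 'cV[R]_n)
    (xhat : 'cV[R]_n) (Xhat : 'M[R]_n)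
    (hv : (3 <= norm0 v)%N)
    (hsym : Xhat^T = Xhat)
    (hQPB : ~ QPB (xhat, Xhat))
    (hSDP : sdp_constraint xhat Xhat)
    (hMC : mccormick xhat Xhat)
    (hdiag : forall i : 'I_n, Xhat i i <= xhat i 0) :
  ecg_depth v0 v xhat Xhat
    <= 2 / Num.sqrt ((norm0 v)%:R * ((norm0 v)%:R - 2)).
Proof.
have X0 i j : i != j -> 0 <= Xhat i j by move=> /hMC[].
(* With at least three indices, each [i] has some [j != i], and the McCormick
   inequalities sandwich [X_ij] between 0 and [x_i]. *)
have x0 i : 0 <= xhat i 0.
  have [j ji] : exists j, j != i.
    apply/existsP; rewrite -negb_forall; apply: contraTN hv => /forallP all_i.
    rewrite -ltnNge ltnS (leq_trans (max_card _)) //.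
    rewrite (@leq_trans 1%N) //.
    by apply/card_le1_eqP => a b _ _; rewrite (eqP (all_i a)) (eqP (all_i b)).
  by rewrite eq_sym in ji; case: (hMC _ _ ji) => + _ + _ => /[swap]; exact: le_trans.
have viol := ecg_violation_le1 _ _ v0 v _ _ hSDP hdiag x0 X0.
have norm_ge := ecg_beta_norm_ge _ _ v.
set k : R := (norm0 v)%:R in norm_ge *.
have k3 : 3 <= k by rewrite /k (ler_nat _ 3).
have kk_gt0 : 0 < k * (k - 2) by nra.
rewrite /ecg_depth; set S := \sum_i _ + _.
have S_ge : k * (k - 2) / 4 <= S.
  by rewrite -[leLHS]addr0 lerD // sumr_ge0 // => i _; exact: sqr_ge0.
have S_gt0 : 0 < S by lra.
rewrite ler_pdivrMr ?sqrtr_gt0 //; apply: le_trans viol _.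
rewrite mulrAC ler_pdivlMr ?sqrtr_gt0 // mul1r.
have -> : 2 * Num.sqrt S = Num.sqrt (4 * S).
  by rewrite sqrtrM // (_ : 4 = 2 ^+ 2) ?sqrtr_sqr ?normr_nat // -natrX.
by apply: ler_wsqrtr; lra.
Qed.
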